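(* Let $\Gamma\subset X$ be a non-recurrent set, $g_i\in\mathcal{C}(\Gamma)$, $i=1,\ldots,n_\lambda$, and $\lambda\in\mathbb{C}$. Then the subspace $$\mathrm{span}\{\psi_{\lambda,g_1},\ldots,\psi_{\lambda,g_{n_\lambda}}\}\subset\mathcal{C}(X_T)$$ is invariant under the action of the Koopman semigroup $\mathcal{K}_t$. Moreover, with $\boldsymbol\psi=[\psi_{\lambda,g_1},\ldots,\psi_{\lambda,g_{n_\lambda}}]^\top$, $$\boldsymbol\psi(S_t(x))=e^{J_\lambda t}\boldsymbol\psi(x)$$ and $$\frac{d}{dt}\boldsymbol\psi(S_t(x))=J_\lambda\boldsymbol\psi(S_t(x))$$ for any $x\in X_T$ and any $t\in[0,T]$ such that $S_{t'}(x)\in X_T$ for all $t'\in[0,t]$.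
   Context: Let $X\subset\mathbb{R}^n$ and let $f$ be a Lipschitz continuous vector field on $X$. Consider the dynamical system $\dot x=f(x)$ with state $x\in X$. Its flow is denoted by $S_t(x)$, i.e. $\frac{d}{dt}S_t(x)=f(S_t(x))$, $S_0(x)=x$, and it is assumed to be well defined for all $x\in X$ and all $t\ge 0$; for $t<0$, $S_t(x)$ denotes the backward flow where it exists. $\mathcal{C}(Y)$ denotes the space of continuous complex-valued functions on a set $Y\subset\mathbb{R}^n$; spans are over $\mathbb{C}$. The Koopman semigroup acts by $\mathcal{K}_t h=h\circ S_t$, $t\ge0$; for functions $h$ defined only on $X_T$ (below), the composition $(\mathcal{K}_th)(x)=h(S_t(x))$ is considered for $x\in X_T$ and $t\in[0,T]$ such that $S_{t'}(x)\in X_T$ for all $t'\in[0,t]$. Fix $T\in(0,\infty)$. A set $\Gamma\subset X$ is called non-recurrent if $x\in\Gamma$ implies $S_t(x)\notin\Gamma$ for all $t\in(0,T]$. Set $X_T=\bigcup_{t\in[0,T]}S_t(\Gamma)=\bigcup_{t\in[0,T]}\{S_t(x_0)\mid x_0\in\Gamma\}$. For $x\in X_T$, $\tau(x)\in[-T,0]$ denotes the (unique, by non-recurrence) time $t\in[-T,0]$ such that $S_t(x)\in\Gamma$. $J_\lambda$ denotes the $n_\lambda\times n_\lambda$ Jordan block with $\lambda$ on the diagonal, $1$ on the superdiagonal and zeros elsewhere. Given $g_1,\ldots,g_{n_\lambda}\in\mathcal{C}(\Gamma)$, the functions $\psi_{\lambda,g_1},\ldots,\psi_{\lambda,g_{n_\lambda}}:X_T\to\mathbb{C}$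 are defined jointly by $$\begin{bmatrix}\psi_{\lambda,g_1}(x)\\ \vdots\\ \psi_{\lambda,g_{n_\lambda}}(x)\end{bmatrix}=e^{-J_\lambda\tau(x)}\begin{bmatrix}g_1(S_{\tau(x)}(x))\\ \vdots\\ g_{n_\lambda}(S_{\tau(x)}(x))\end{bmatrix},\qquad x\in X_T,$$ equivalently $[\psi_{\lambda,g_1}(S_t(x_0)),\ldots,\psi_{\lambda,g_{n_\lambda}}(S_t(x_0))]^\top=e^{J_\lambda t}[g_1(x_0),\ldots,g_{n_\lambda}(x_0)]^\top$ for all $x_0\in\Gamma$, $t\in[0,T]$.
   Formalization: The inclusion of the span in C(X_T) is stated only when τ is continuous on X_T; without this it fails, e.g. f=(1,0) on R², T=1, Γ={(0,y): y≤0}∪{(1/2,y): y>0}, λ=1, g=1. Invariance and both formulas are unconditional. *)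

(* Defs.v *)
From HB Require Import structures.
From mathcomp Require Import all_boot all_order all_algebra.
From mathcomp Require Import all_classical all_reals all_analysis.
From mathcomp Require Export complex.

Set Implicit Arguments.
Unset Strict Implicit.
Unset Printing Implicit Defensive.

Import Order.TTheory GRing.Theory Num.Theory.
Import numFieldNormedType.Exports.
Local Open Scope classical_set_scope.
Local Open Scope ring_scope.
Local Open Scope complex_scope.

(* R[i] carries no topology in the libraries: give it the one of its modulus,
   that is, the normed-space structure of a numFieldType over itself. *)
HB.instance Definition _ (R : rcfType) := NormedModule.copy R[i] R[i]^o.

Section Derivative.
Context {R : realType} {K : numFieldType} {V : normedModType K}.

(* Derivative relative to D of a curve in a normed space over K, the real time
   increments being mapped to scalars by iota (the identity for K = R, the
   inclusion for K = R[i]).  It is one-sided at an endpoint of an interval D,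
   and there is no constraint at an isolated point of D. *)
Definition is_derive_within (iota : R -> K) (D : set R) (u : R -> V) (t : R)
    (v : V) : Prop :=
  (iota (s - t))^-1 *: (u s - u t) @[s --> within D t^'] --> v.

End Derivative.

Section Flow.
Context {R : realType} {n : nat}.
Implicit Types (X Gamma : set 'rV[R]_n) (f : 'rV[R]_n -> 'rV[R]_n).

Definition trajectory X f (a b : R) (u : R -> 'rV[R]_n) : Prop :=
  forall t, t \in `[a, b] ->
    X (u t) /\ is_derive_within idfun [set` `[a, b]] u t (f (u t)).

(* y is reached from x at time t, forward if t >= 0, backward if t <= 0. *)
Definition flow_to X f (t : R) (x y : 'rV[R]_n) : Prop :=
  exists u, [/\ trajectory X f (Num.min 0 t) (Num.max 0 t) u,
                u 0 = x & u t = y].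

Definition flow_defined X f (t : R) (x : 'rV[R]_n) : Prop :=
  exists y, flow_to X f t x y.

(* S_t(x); the value is meaningless unless flow_defined X f t x. *)
Definition flow X f (t : R) (x : 'rV[R]_n) : 'rV[R]_n :=
  xget x [set y | flow_to X f t x y].

Definition nonrecurrent X f (T : R) Gamma : Prop :=
  forall x, Gamma x -> forall t, t \in `]0, T] -> ~ Gamma (flow X f t x).

Definition flowout X f (T : R) Gamma : set 'rV[R]_n :=
  \bigcup_(t in [set` `[0, T]]) (flow X f t @` Gamma).

Definition hitting_time X f (T : R) Gamma (x : 'rV[R]_n) : R :=
  xget 0 [set t | [/\ t \in `[- T, 0], flow_defined X f t x &
                      Gamma (flow X f t x)]].

(* The points x of X_T at which K_t h is considered, for h defined on X_T. *)
Definition koopman_dom X f (T : R) Gamma (t : R) : set 'rV[R]_n :=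
  [set x | flowout X f T Gamma x /\
           forall t', t' \in `[0, t] -> flowout X f T Gamma (flow X f t' x)].

Definition koopman X f (t : R) (h : 'rV[R]_n -> R[i]) : 'rV[R]_n -> R[i] :=
  h \o flow X f t.

(* A function on a set Y is represented by any total function extending it; in
   particular the linear combinations are only required to hold on Y. *)
Definition span_on (Y : set 'rV[R]_n) (m : nat)
    (psi : 'I_m -> 'rV[R]_n -> R[i]) : set ('rV[R]_n -> R[i]) :=
  [set h | exists c : 'I_m -> R[i],
     forall x, Y x -> h x = \sum_(i < m) c i * psi i x].

Definition continuous_on (Y : set 'rV[R]_n) : set ('rV[R]_n -> R[i]) :=
  [set h | {within Y, continuous h}].

Definition koopman_invariant X f (T : R) Gamma
    (F : set ('rV[R]_n -> R[i])) : Prop :=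
  forall t h, t \in `[0, T] -> F h ->
    exists2 h', F h' & {in koopman_dom X f T Gamma t, koopman X f t h =1 h'}.

End Flow.

Section Eigenfunctions.
Context {R : realType}.

Definition jordan_block (m : nat) (lambda : R[i]) : 'M[R[i]]_m :=
  \matrix_(i, j) if i == j then lambda
                 else if j == i.+1 :> nat then 1 else 0.

Definition expmx (m : nat) (A : 'M[R[i]]_m) : 'M[R[i]]_m :=
  limn (series (fun k => (k`!%:R)^-1 *: A ^+ k)).

Definition psi_vec (n : nat) (X : set 'rV[R]_n) (f : 'rV[R]_n -> 'rV[R]_n)
    (T : R) (Gamma : set 'rV[R]_n) (m : nat) (lambda : R[i])
    (g : 'I_m -> 'rV[R]_n -> R[i]) (x : 'rV[R]_n) : 'cV[R[i]]_m :=
  let tau := hitting_time X f T Gamma x in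
  expmx ((- tau)%:C *: jordan_block m lambda) *m
    (\col_i g i (flow X f tau x)).

End Eigenfunctions.

(* Main.v *)
Require Import Defs.
From HB Require Import structures.
From mathcomp Require Import all_boot all_order all_algebra.
From mathcomp Require Import all_classical all_reals all_analysis.
From mathcomp Require Import ring lra.

Set Implicit Arguments.
Unset Strict Implicit.
Unset Printing Implicit Defensive.

Import Order.TTheory GRing.Theory Num.Theory.
Import numFieldNormedType.Exports.
Local Open Scope classical_set_scope.
Local Open Scope ring_scope.
Local Open Scope complex_scope.

(** Along a trajectory that starts at [x0] in [Gamma], the vector psi is
    [expmx (a J) g(x0)] at time [a]; hence moving on by [t] multiplies it by
    [expmx (t J)], and everything algebraic follows from the group law and the
    derivative of [t |-> expmx (t J)].  The substance is that the formula for psi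
    may be used at both [x] and [S_t x], with the same [x0].

    Exponential.  The entries of [expmx (t A)] have as real and imaginary parts
    real power series with coefficients bounded by [M K^k / k!].  Termwise
    differentiation gives [E' = A E] ([expmx_derive]); the product
    [E(-t) E(t+s)] then has zero derivative, whence the group law ([expmxD]).

    Flow.  Trajectories are only known to stay in the arbitrary set [X] and to
    have one-sided derivatives at the endpoints.  A Gronwall inequality for the
    squared Euclidean distance ([approx_trajectory_dist]) makes them unique
    forwards and backwards in time, so that the flow can be read along any
    trajectory ([flow_along]).  With non-recurrence, this shows that the hitting
    time of the point reached from [x0] at time [a <= T] is exactly [-a]
    ([hitting_time_along]).

    No overrun.  Suppose that [x] is reached from [x0] at time [a] and that the
    trajectory stays in the flowout up to time [c = a + t].  If [c > T], then every
    point reached at a time [s > T] comes from a point of [Gamma] met at most [T]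
    earlier; by non-recurrence that passage through [Gamma] happened after time
    [T].  So there are passages arbitrarily soon after [T], hence two of them less
    than [T] apart, which non-recurrence forbids.  Therefore [a + t <= T]
    ([stay_time_le]), and [S_t x] has hitting time [-(a + t)] ([psi_flow]).

    Continuity.  When the hitting time is continuous on the flowout, so is the map
    sending [x] to its starting point in [Gamma]: the same Gronwall inequality
    bounds the distance between two starting points by that of the end points and
    the difference of the travel times ([start_dist], [entrance_continuous]). *)

(** * Limits and derivatives of complex-valued functions of a real variable *)

Section ComplexLimits.
Context {R : realType}.
Local Notation C := R[i].

Lemma ReD (x y : C) : complex.Re (x + y) = complex.Re x + complex.Re y.
Proof. by case: x; case: y. Qed.

Lemma ImD (x y : C) : complex.Im (x + y) = complex.Im x + complex.Im y.
Proof. by case: x; case: y. Qed.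

Lemma ReM (x y : C) : complex.Re (x * y) =
  complex.Re x * complex.Re y - complex.Im x * complex.Im y.
Proof. by case: x; case: y. Qed.

Lemma ImM (x y : C) : complex.Im (x * y) =
  complex.Re x * complex.Im y + complex.Im x * complex.Re y.
Proof. by case: x => a b; case: y => c d /=. Qed.

Lemma complex_cvg {T} (F : set_system T) {FF : Filter F} (u : T -> C) (l : C) :
  complex.Re (u x) @[x --> F] --> complex.Re l ->
  complex.Im (u x) @[x --> F] --> complex.Im l -> u @ F --> l.
Proof.
have cC : continuous (real_complex R).
  move=> x; apply/cvgrPdist_lt => e /= e0.
  have eE : e = (complex.Re e)%:C by rewrite RRe_real // gtr0_real.
  have e0' : 0 < complex.Re e by rewrite -ltcR -eE.
  near=> y.
  rewrite -rmorphB /= normc_def /= expr0n addr0 sqrtr_sqr eE ltcR.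
  near: y; exact: cvgr_dist_lt.
move=> hr hi; rewrite (complexE l).
rewrite (_ : u =
    fun x => (complex.Re (u x))%:C + 'i%C * (complex.Im (u x))%:C); last first.
  by apply/funext => x; rewrite -complexE.
apply: cvgD; first by apply: continuous_cvg => //; exact: cC.
by apply: cvgM; [exact: cvg_cst | apply: continuous_cvg => //; exact: cC].
Unshelve. all: end_near. Qed.

Lemma complex_hausdorff : hausdorff_space C.
Proof. exact: norm_hausdorff. Qed.

Lemma mx_complex_hausdorff m p : hausdorff_space 'M[C]_(m,p).
Proof. exact: norm_hausdorff. Qed.

Lemma mx_cvg {T} (F : set_system T) {FF : Filter F} m p
    (u : T -> 'M[C]_(m, p)) (l : 'M[C]_(m, p)) :
  (forall i j, u x i j @[x --> F] --> l i j) -> u @ F --> l.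
Proof.
move=> h A [P lP sPA]; rewrite nbhs_simpl.
have : F (fun x => forall ij : 'I_m * 'I_p, P ij.1 ij.2 (u x ij.1 ij.2)).
  apply: (filter_forall (f := fun ij x => P ij.1 ij.2 (u x ij.1 ij.2))).
  by case=> i j; exact: (h i j _ (lP i j)).
suff sub : [set x | forall ij : 'I_m * 'I_p, P ij.1 ij.2 (u x ij.1 ij.2)] `<=`
  u @^-1` A by apply: filterS sub.
by move=> x hx; apply: sPA => i j; exact: (hx (i, j)).
Qed.

End ComplexLimits.

(** The derivative as a limit over the moving end point instead of the increment:
    the form in which one-sided derivatives relative to a set are stated. *)
Lemma is_derive_slope {R : realType} (h : R -> R) (t dh : R) :
  is_derive t 1 h dh <-> (s - t)^-1 * (h s - h t) @[s --> t^'] --> dh.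
Proof.
have slope_at0 : (fun k => k^-1 *: ((h \o shift t) (k *: 1) - h t)) @ 0^' =
    (s - t)^-1 * (h s - h t) @[s --> t^'].
  rewrite predeqE => A; rewrite -propeqE.
  transitivity (\forall k \near (0 : R), k != 0 ->
    A (k^-1 *: ((h \o shift t) (k *: 1) - h t))) => //.
  rewrite (near_shift t); apply: eq_near => s /=.
  by rewrite sub0r subr_eq0 /GRing.scale /= mulr1 subrK.
split=> [[dbl <-]|hdh]; first by rewrite -slope_at0.
rewrite -slope_at0 in hdh.
by split; [apply/cvg_ex; exists dh | exact: cvg_lim].
Qed.

Section ComplexDerivative.
Context {R : realType}.
Local Notation C := R[i].
Implicit Types (F G : R -> C) (t : R).

(** Differentiation of curves in the complex plane, through the two coordinates:
    [R[i]] is a normed space over itself, not over [R], so that [is_derive] does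
    not apply to them. *)
Definition is_cderive F t (dF : C) :=
  is_derive t 1 (fun s => complex.Re (F s)) (complex.Re dF) /\
  is_derive t 1 (fun s => complex.Im (F s)) (complex.Im dF).

Lemma is_cderive_cst (c : C) t : is_cderive (fun=> c) t 0.
Proof. by split; exact: is_derive_cst. Qed.

Lemma is_cderiveD F G t dF dG : is_cderive F t dF -> is_cderive G t dG ->
  is_cderive (fun s => F s + G s) t (dF + dG).
Proof.
move=> [Fr Fi] [Gr Gi]; split.
- rewrite ReD; under eq_fun do rewrite ReD; exact: is_deriveD.
- rewrite ImD; under eq_fun do rewrite ImD; exact: is_deriveD.
Qed.

Lemma is_cderiveM F G t dF dG : is_cderive F t dF -> is_cderive G t dG ->
  is_cderive (fun s => F s * G s) t (dF * G t + F t * dG).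
Proof.
move=> [Fr Fi] [Gr Gi]; split.
- have := is_deriveB (is_deriveM Fr Gr) (is_deriveM Fi Gi).
  rewrite (_ : _ - _ = fun s => complex.Re (F s * G s)); last first.
    by apply/funext => s; rewrite ReM.
  by move/is_derive_eq; apply; rewrite ReD !ReM /GRing.scale /=; ring.
- have := is_deriveD (is_deriveM Fr Gi) (is_deriveM Fi Gr).
  rewrite (_ : _ + _ = fun s => complex.Im (F s * G s)); last first.
    by apply/funext => s; rewrite ImM.
  by move/is_derive_eq; apply; rewrite ImD !ImM /GRing.scale /=; ring.
Qed.

Lemma is_cderive_sum m (F : 'I_m -> R -> C) t (dF : 'I_m -> C) :
  (forall i, is_cderive (F i) t (dF i)) ->
  is_cderive (fun s => \sum_i F i s) t (\sum_i dF i).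
Proof.
elim: m F dF => [|m IH] F dF hF.
  under eq_fun do rewrite big_ord0.
  by rewrite big_ord0; exact: is_cderive_cst.
under eq_fun do rewrite big_ord_recr /=.
by rewrite big_ord_recr /=; apply: is_cderiveD => //; exact: IH.
Qed.

Lemma is_cderive_affine F (e r t : R) dF : is_cderive F (e * t + r) dF ->
  is_cderive (fun s => F (e * s + r)) t (e%:C * dF).
Proof.
have d : is_derive t 1 (fun s => e * s + r) e.
  have := is_deriveD (is_deriveZ e (is_derive_id t 1)) (is_derive_cst r t 1).
  by move/is_derive_eq; apply; rewrite addr0 /GRing.scale /= mulr1.
move=> [Fr Fi]; split.
- have := is_derive1_comp (f := fun s => complex.Re (F s))
                          (g := fun s => e * s + r) Fr d.
  by rewrite ReM /= mul0r subr0 mulrC.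
- have := is_derive1_comp (f := fun s => complex.Im (F s))
                          (g := fun s => e * s + r) Fi d.
  by rewrite ImM /= mul0r addr0 mulrC.
Qed.

Lemma is_cderiveNarg F t dF : is_cderive F (- t) dF ->
  is_cderive (fun s => F (- s)) t (- dF).
Proof.
move=> hF; have := @is_cderive_affine F (-1) 0 t dF.
rewrite rmorphN1 !mulN1r addr0 => /(_ hF); congr is_cderive.
by apply/funext => s; rewrite mulN1r addr0.
Qed.

Lemma is_cderive_shift F r t dF : is_cderive F (t + r) dF ->
  is_cderive (fun s => F (s + r)) t dF.
Proof.
rewrite -[t in t + r]mul1r => /is_cderive_affine; rewrite rmorph1 mul1r.
by congr is_cderive; apply/funext => s; rewrite mul1r.
Qed.

Lemma is_cderive_mulmxl m p q (E : R -> 'M[C]_(m, p)) (dE : 'M[C]_(m, p))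
    (c : 'M[C]_(p, q)) t i j :
  (forall k, is_cderive (fun s => E s i k) t (dE i k)) ->
  is_cderive (fun s => (E s *m c) i j) t ((dE *m c) i j).
Proof.
move=> hE; rewrite mxE; under eq_fun do rewrite mxE.
apply: is_cderive_sum => k.
have := is_cderiveM (hE k) (is_cderive_cst (c k j) t).
by rewrite mulr0 addr0.
Qed.

Lemma is_cderive0_cst F (x y : R) : (forall t, is_cderive F t 0) -> F x = F y.
Proof.
move=> hF; apply/eqP; rewrite eq_complex; apply/andP; split; apply/eqP.
- apply: (is_derive_0_is_cst (f := fun s => complex.Re (F s))) => t.
  by have [] := hF t.
- apply: (is_derive_0_is_cst (f := fun s => complex.Im (F s))) => t.
  by have [] := hF t.
Qed.

Lemma is_cderive_continuous F t dF : is_cderive F t dF ->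
  {for t, continuous F}.
Proof.
move=> [Fr Fi]; apply: complex_cvg.
- apply: (@differentiable_continuous _ _ _ t (fun s => complex.Re (F s))).
  exact/derivable1_diffP/ex_derive.
- apply: (@differentiable_continuous _ _ _ t (fun s => complex.Im (F s))).
  exact/derivable1_diffP/ex_derive.
Qed.

Lemma is_cderive_within F t dF (D : set R) : is_cderive F t dF ->
  is_derive_within (fun s => s%:C) D (fun s => F s : C) t dF.
Proof.
move=> [Fr Fi].
have key (h : R -> R) dh : is_derive t 1 h dh ->
    (s - t)^-1 * (h s - h t) @[s --> within D t^'] --> dh.
  move=> /is_derive_slope; apply: cvg_trans; apply: cvg_app.
  exact: cvg_within.
rewrite /is_derive_within.
have E s : (s - t)%:C^-1 *: (F s - F t) =
   ((s - t)^-1 * (complex.Re (F s) - complex.Re (F t))) +i*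
   ((s - t)^-1 * (complex.Im (F s) - complex.Im (F t))).
  rewrite -fmorphV /GRing.scale /=; case: (F s); case: (F t) => a b c d.
  apply/eqP; rewrite eq_complex /=; apply/andP; split; apply/eqP; ring.
under eq_fun do rewrite E.
by apply: complex_cvg; apply: key.
Qed.

Lemma is_cderive_within_mx p q (F : R -> 'M[C]_(p, q)) t (dF : 'M[C]_(p, q))
    (D : set R) :
  (forall i j, is_cderive (fun s => F s i j) t (dF i j)) ->
  is_derive_within (fun s => s%:C) D F t dF.
Proof.
move=> hF; apply: mx_cvg => i j; have := is_cderive_within D (hF i j).
by apply: cvg_trans; apply: near_eq_cvg; near=> s; rewrite !mxE.
Unshelve. all: end_near. Qed.

End ComplexDerivative.

(** * Exponential generating series *)

Section ScalarExponential.
Context {R : realType}.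
Local Notation C := R[i].

Definition geo_dominated (a : nat -> R) :=
  exists M K : R, [/\ 0 <= M, 0 <= K & forall k, `|a k| <= M * K ^+ k].

Definition egf_coeff (a : nat -> R) (k : nat) : R := (k`!%:R)^-1 * a k.

Lemma egf_cvg a (t : R) : geo_dominated a -> cvgn (pseries (egf_coeff a) t).
Proof.
move=> [M [K [M0 K0 aMK]]]; apply: normed_cvg; rewrite /normed_series_of /=.
apply: (@series_le_cvg _ _ (fun k => M * exp_coeff (K * `|t|) k)) => [//|k|k|].
- by rewrite mulr_ge0 // exp_coeff_ge0 // mulr_ge0.
- rewrite /exp_coeff /egf_coeff /= !normrM normrX exprMn ger0_norm ?invr_ge0//.
  have -> : M * (K ^+ k * `|t| ^+ k / k`!%:R) =
            k`!%:R^-1 * (M * K ^+ k) * `|t| ^+ k by ring.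
  by rewrite ler_wpM2r ?exprn_ge0 // ler_wpM2l ?invr_ge0.
- rewrite (_ : (fun _ => _) = M *: exp_coeff (K * `|t|)) //.
  exact/is_cvg_seriesZ/is_cvg_series_exp_coeff.
Qed.

Lemma pseries_diffs_egf_coeff a :
  pseries_diffs (egf_coeff a) = egf_coeff (fun k => a k.+1).
Proof.
apply/funext => k; rewrite /pseries_diffs /egf_coeff factS natrM invfM.
by rewrite mulrA mulVKf.
Qed.

(** Dividing the coefficients by factorials turns termwise differentiation into a
    shift of the sequence.  Domination is stable under shifts, so the series and
    its first two derived series converge everywhere. *)
Lemma egf_derive a (t : R) : geo_dominated a ->
  is_derive t (1 : R) (fun x => limn (pseries (egf_coeff a) x))
    (limn (pseries (egf_coeff (fun k => a k.+1)) t)).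
Proof.
have S b : geo_dominated b -> geo_dominated (fun k => b k.+1).
  move=> [M [K [M0 K0 bMK]]]; exists (M * K), K; split=> //.
    exact: mulr_ge0.
  by move=> k; rewrite -mulrA -exprS.
move=> ha; rewrite -pseries_diffs_egf_coeff.
apply: (@pseries_snd_diffs _ _ (`|t| + 1)).
- exact: egf_cvg.
- by rewrite pseries_diffs_egf_coeff; apply: egf_cvg; exact: (S _ ha).
- by rewrite !pseries_diffs_egf_coeff; apply: egf_cvg; exact: (S _ (S _ ha)).
- by rewrite (@ger0_norm _ (_ + 1)) ?addr_ge0 // ltrDl.
Qed.


Definition cgeo_dominated (a : nat -> C) :=
  exists M K : R, [/\ 0 <= M, 0 <= K & forall k, `|a k| <= (M * K ^+ k)%:C].

Definition cegf (a : nat -> C) (t : R) : C :=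
  limn (pseries (egf_coeff (fun k => complex.Re (a k))) t) +i*
  limn (pseries (egf_coeff (fun k => complex.Im (a k))) t).

Lemma eq_cegf a b t : a =1 b -> cegf a t = cegf b t.
Proof. by move=> /funext ->. Qed.

Lemma cgeo_dominated_Re a : cgeo_dominated a ->
  geo_dominated (fun k => complex.Re (a k)).
Proof.
move=> [M [K [M0 K0 h]]]; exists M, K; split=> // k.
by rewrite -lecR; apply: (le_trans _ (h k)); exact: normc_ge_Re.
Qed.

Lemma cgeo_dominated_Im a : cgeo_dominated a ->
  geo_dominated (fun k => complex.Im (a k)).
Proof.
move=> [M [K [M0 K0 h]]]; exists M, K; split=> // k.
rewrite -lecR -normrN -ReiNIm; apply: (le_trans _ (h k)).
apply: le_trans (normc_ge_Re _) _.
by rewrite normrM [`|'i%C|]normc_def /= expr0n expr1n add0r sqrtr1 mulr1.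
Qed.

(** Besides convergence, this provides the principle used to compute with [cegf]:
    an identity between partial sums passes to the limit. *)
Lemma cegf_cvg a (t : R) : cgeo_dominated a ->
  series (fun k => (k`!%:R)^-1 * (t%:C ^+ k * a k)) @ \oo --> cegf a t.
Proof.
move=> ha.
have Ek k : (k`!%:R)^-1 * (t%:C ^+ k * a k) =
    ((k`!%:R)^-1 * t ^+ k)%:C * a k.
  by rewrite rmorphM fmorphV rmorph_nat rmorphXn /= mulrA.
have ReS n : complex.Re (series (fun k => (k`!%:R)^-1 * (t%:C ^+ k * a k)) n) =
    pseries (egf_coeff (fun k => complex.Re (a k))) t n.
  rewrite /pseries /series /= (big_morph _ ReD (erefl : complex.Re 0 = 0)).
  by apply: eq_bigr => k _; rewrite Ek ReM /egf_coeff /=; ring.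
have ImS n : complex.Im (series (fun k => (k`!%:R)^-1 * (t%:C ^+ k * a k)) n) =
    pseries (egf_coeff (fun k => complex.Im (a k))) t n.
  rewrite /pseries /series /= (big_morph _ ImD (erefl : complex.Im 0 = 0)).
  by apply: eq_bigr => k _; rewrite Ek ImM /egf_coeff /=; ring.
apply: complex_cvg.
- under eq_fun do rewrite ReS; exact/egf_cvg/cgeo_dominated_Re.
- under eq_fun do rewrite ImS; exact/egf_cvg/cgeo_dominated_Im.
Qed.

Lemma cegf_derive a (t : R) : cgeo_dominated a ->
  is_cderive (cegf a) t (cegf (fun k => a k.+1) t).
Proof.
by move=> ha; split => /=; apply: egf_derive;
  [exact: cgeo_dominated_Re | exact: cgeo_dominated_Im].
Qed.

End ScalarExponential.

(** * The matrix exponential *)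

Section MatrixExponential.
Context {R : realType} {m : nat}.
Local Notation C := R[i].
Implicit Types A : 'M[C]_m.

(** The sum [M] of the moduli of all entries bounds every row sum, so the entries
    of the powers grow at most like the powers of [M]. *)
Lemma mx_pow_dominated A i j : cgeo_dominated (fun k => (A ^+ k) i j).
Proof.
pose M := \sum_i \sum_j complex.Re `|A i j|.
have nE (z : C) : `|z| = (complex.Re `|z|)%:C by rewrite normc_def.
have M0 : 0 <= M.
  by apply: sumr_ge0 => p _; apply: sumr_ge0 => q _; rewrite -ler0c -nE.
have AM p : \sum_q complex.Re `|A p q| <= M.
  rewrite [leRHS](bigD1 p) //= lerDl; apply: sumr_ge0 => l _.
  by apply: sumr_ge0 => q _; rewrite -ler0c -nE.
exists 1, M; split=> // k; rewrite mul1r; elim: k i j => [|k IH] i j.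
  rewrite !expr0 (_ : (1 : 'M[C]_m) = 1%:M) // mxE.
  case: (i == j); first by rewrite normr1.
  by rewrite normr0 lecR ler01.
rewrite exprS -[A * _]/(A *m _) mxE; apply: le_trans (ler_norm_sum _ _ _) _.
apply: (@le_trans _ _ (\sum_l `|A i l| * (M ^+ k)%:C)).
  by apply: ler_sum => l _; rewrite normrM ler_wpM2l.
rewrite -mulr_suml (eq_bigr (fun l => (complex.Re `|A i l|)%:C)); last first.
  by move=> *; exact: nE.
by rewrite -rmorph_sum -rmorphM lecR exprS ler_wpM2r // exprn_ge0.
Qed.

Lemma mx_exprZ (c : C) A k : (c *: A) ^+ k = c ^+ k *: A ^+ k.
Proof.
elim: k => [|k IH]; first by rewrite !expr0 scale1r.
rewrite !exprS IH -[LHS]/(_ *m _) -scalemxAl -scalemxAr scalerA.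
by rewrite -[A *m _]/(A * _).
Qed.

Lemma expmx_cegf A (t : R) i j :
  expmx (t%:C *: A) i j = cegf (fun k => (A ^+ k) i j) t.
Proof.
rewrite /expmx.
rewrite (_ : limn _ = \matrix_(i, j) cegf (fun k => (A ^+ k) i j) t) ?mxE//.
apply: (cvg_lim (@mx_complex_hausdorff _ _ _)).
apply: mx_cvg => p q; rewrite mxE.
rewrite [X in X @ _ --> _](_ : _ =
    series (fun k => (k`!%:R)^-1 * (t%:C ^+ k * (A ^+ k) p q))).
  exact/cegf_cvg/mx_pow_dominated.
apply/funext => N; rewrite /series /= summxE; apply: eq_bigr => k _.
by rewrite mx_exprZ !mxE.
Qed.

Lemma mulmx_expmx A (t : R) : A *m expmx (t%:C *: A) =
  \matrix_(i, j) cegf (fun k => (A ^+ k.+1) i j) t.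
Proof.
apply/matrixP => i j; rewrite !mxE.
have dom : cgeo_dominated (fun k => (A ^+ k.+1) i j).
  have [M [K [M0 K0 h]]] := mx_pow_dominated A i j.
  exists (M * K), K; split=> // [|k]; first exact: mulr_ge0.
  by rewrite -mulrA -exprS.
apply: (cvg_unique (@complex_hausdorff R) _ (cegf_cvg (t := t) dom)).
under eq_fun do rewrite /series /=.
rewrite (_ : (fun n => _) = fun n => \sum_l A i l *
    series (fun k => (k`!%:R)^-1 * (t%:C ^+ k * (A ^+ k) l j)) n).
  apply: (cvg_big add_continuous) => l _; apply: cvgM; first exact: cvg_cst.
  rewrite expmx_cegf; apply: cegf_cvg; exact: mx_pow_dominated.
apply/funext => n; rewrite /series /=.
under [RHS]eq_bigr do rewrite mulr_sumr.
rewrite exchange_big; apply: eq_bigr => k _.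
rewrite exprS -[A * _]/(A *m _) mxE !mulr_sumr; apply: eq_bigr => l _; ring.
Qed.

(** Both products have the series of [A ^+ k.+1]; transposition exchanges left and
    right multiplication by [A], and so reduces this to [mulmx_expmx]. *)
Lemma expmx_comm A (t : R) : expmx (t%:C *: A) *m A = A *m expmx (t%:C *: A).
Proof.
have powT (B : 'M[C]_m) k : (B^T) ^+ k = (B ^+ k)^T.
  elim: k => [|k IH].
    by rewrite !expr0 (_ : (1 : 'M[C]_m) = 1%:M) // trmx1.
  by rewrite exprS IH exprSr -[_ * _ in LHS]/(_ *m _) -trmx_mul.
have expT : (expmx (t%:C *: A))^T = expmx (t%:C *: A^T).
  apply/matrixP => i j; rewrite [LHS]mxE [LHS]expmx_cegf [RHS]expmx_cegf.
  by apply: eq_cegf => k; rewrite (powT A) [RHS]mxE.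
apply: trmx_inj; rewrite trmx_mul expT !mulmx_expmx.
apply/matrixP => i j; rewrite [in LHS]mxE [in RHS]mxE [in RHS]mxE.
by apply: eq_cegf => k; rewrite (powT A) [LHS]mxE.
Qed.

Lemma expmx0 : expmx (0 : 'M[C]_m) = 1%:M.
Proof.
rewrite /expmx; apply: lim_near_cst; first exact: mx_complex_hausdorff.
near=> n; rewrite /series /=.
have n0 : (0 < n)%N by near: n; exact: nbhs_infty_gt.
rewrite big_ltn // big_nat_cond big1 ?addr0 => [|k /andP[/andP[k0 _] _]].
  by rewrite expr0 fact0 invr1 scale1r.
by rewrite expr0n (gtn_eqF k0) scaler0.
Unshelve. all: end_near. Qed.

Lemma expmx_derive A (t : R) i j :
  is_cderive (fun s => expmx (s%:C *: A) i j) t ((A *m expmx (t%:C *: A)) i j).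
Proof.
under eq_fun do rewrite expmx_cegf.
rewrite mulmx_expmx mxE; apply: cegf_derive; exact: mx_pow_dominated.
Qed.

(** By the product rule and commutation, the derivative in [t] of
    [E (- t) *m E (t + s)] is [- E A E + E A E = 0]; its value at 0 is [E s]. *)
Lemma exponential_shift A (E : R -> 'M[C]_m) (s t : R) :
  E 0 = 1%:M -> (forall t, E t *m A = A *m E t) ->
  (forall t i j, is_cderive (fun s => E s i j) t ((A *m E t) i j)) ->
  E (- t) *m E (t + s) = E s.
Proof.
move=> E0 EA dE; pose H (t : R) := E (- t) *m E (t + s).
have dH i j (r : R) : is_cderive (fun r => H r i j) r 0.
  have d l := is_cderiveM (is_cderiveNarg (dE (- r) i l))
                         (is_cderive_shift (dE (r + s) l j)).
  have := is_cderive_sum d.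
  rewrite (_ : (fun _ => \sum_i _) = fun r => H r i j); last first.
    by apply/funext => u; rewrite mxE.
  congr is_cderive; rewrite big_split /=; under eq_bigr do rewrite mulNr.
  rewrite sumrN -EA; have /matrixP/(_ i j) := mulmxA (E (- r)) A (E (r + s)).
  by rewrite 2!mxE => ->; rewrite addNr.
have HE i j : H t i j = H 0 i j.
  exact: (is_cderive0_cst (F := fun r => H r i j) t 0 (dH i j)).
rewrite -/(H t); apply/matrixP => i j; rewrite HE /H.
by rewrite oppr0 add0r E0 mul1mx.
Qed.

Lemma expmxD A (s t : R) :
  expmx ((t + s)%:C *: A) = expmx (t%:C *: A) *m expmx (s%:C *: A).
Proof.
pose E (t : R) := expmx (t%:C *: A).
rewrite -[RHS]/(E t *m E s) -[LHS]/(E (t + s)).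
have E0 : E 0 = 1%:M by rewrite /E rmorph0 scale0r expmx0.
have := @exponential_shift A E (t + s) (- t) E0 (expmx_comm A)
  (@expmx_derive A).
by rewrite opprK addKr.
Qed.

End MatrixExponential.

(** * Gronwall's inequality with one-sided derivatives *)

Section DeriveWithin.
Context {R : realType}.
Implicit Types (D : set R) (t : R).

Lemma derive_within_cvg {V : normedModType R} D (u : R -> V) t v :
  is_derive_within idfun D u t v -> u s @[s --> within D t^'] --> u t.
Proof.
move=> du; rewrite -[X in _ --> X](addr0 (u t)).
rewrite -[X in _ --> _ + X](scale0r v) -(subrr t).
apply: (@cvg_trans _
    (u t + (s - t) *: ((s - t)^-1 *: (u s - u t)) @[s --> within D t^'])).
  apply: near_eq_cvg; apply: cvg_within; near=> s.
  have st : s != t by near: s; exact: nbhs_dnbhs_neq.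
  by rewrite scalerA mulfV ?subr_eq0 // scale1r addrC subrK.
apply: cvgD; first exact: cvg_cst.
apply: cvgZ => //; apply: cvgB; last exact: cvg_cst.
by move=> P /nbhs_dnbhs; exact: cvg_within.
Unshelve. all: end_near. Qed.

Lemma derive_within_continuous {V : normedModType R} D (u dv : R -> V) :
  (forall t, D t -> is_derive_within idfun D u t (dv t)) ->
  {within D, continuous u}.
Proof.
move=> du; apply/subspace_continuousP => t Dt.
have ut := derive_within_cvg (du t Dt).
apply/cvgrPdist_lt => e e0.
move/cvgrPdist_lt: ut => /(_ e e0).
rewrite !near_withinE; apply: filterS => s h Ds.
by have [->|st] := eqVneq s t; [rewrite subrr normr0 | exact: h].
Qed.

Lemma is_derive_within_subset {V : normedModType R} D D' (u : R -> V) t v :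
  D' `<=` D -> is_derive_within idfun D u t v ->
  is_derive_within idfun D' u t v.
Proof.
by move=> DD; apply: cvg_trans; apply: cvg_app; exact: within_subset.
Qed.

Lemma is_derive_within_interior (D : set R) (h : R -> R) t v :
  nbhs t D -> is_derive_within idfun D h t v -> is_derive t 1 h v.
Proof.
move=> Dt dh; apply/is_derive_slope; apply: cvg_trans dh.
apply: cvg_app => A; rewrite /within /dnbhs /= => hA.
by apply: filterS2 Dt hA => s Ds hs st; exact: hs.
Qed.

(** With [c = - A] the function [(w + B / A) exp(c r)] has nonpositive derivative,
    with [c = A] nonnegative derivative: the first comparison bounds [w] forwards
    in time, the second one backwards. *)
Lemma gronwall (w dw : R -> R) (a b A B : R) : 0 < A ->
  (forall t, t \in `[a, b] ->
    is_derive_within idfun [set` `[a, b]] w t (dw t)) ->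
  (forall t, t \in `[a, b] -> `|dw t| <= A * w t + B) ->
  forall s t, s \in `[a, b] -> t \in `[a, b] ->
  w t + B / A <= (w s + B / A) * expR (A * `|t - s|).
Proof.
move=> A0 dwP bnd.
have wc : {within `[a, b], continuous w} by exact: derive_within_continuous dwP.
pose phi c (r : R) := (w r + B / A) * expR (c * r).
have dphi c r : r \in `]a, b[ ->
    is_derive r 1 (phi c) ((dw r + c * (w r + B / A)) * expR (c * r)).
  move=> rab; have rab' : r \in `[a, b] by exact: subset_itv_oo_cc.
  have d : is_derive r 1 w (dw r).
    apply: (@is_derive_within_interior [set` `[a, b]]); last exact: dwP.
    by apply: filterS (near_in_itvoo rab); exact: subset_itv_oo_cc.
  have de : is_derive r 1 (fun r => expR (c * r)) (expR (c * r) * c).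
    apply: (is_derive1_comp (f := expR) (g := fun r => c * r)).
    have := is_deriveZ c (is_derive_id r 1).
    by move/is_derive_eq; apply; rewrite /GRing.scale /= mulr1.
  have := is_deriveM (is_deriveD d (is_derive_cst (B / A) r 1)) de.
  move/is_derive_eq; apply; rewrite addr0 /GRing.scale /=.
  by rewrite -[(w + cst _) r]/(w r + B / A); ring.
have phic k : {within `[a, b], continuous (phi k)}.
  move=> x; apply: cvgM; first by apply: cvgD; [exact: wc | exact: cvg_cst].
  apply: continuous_subspaceT => {}x.
  apply: continuous_comp; last exact: continuous_expR.
  by apply: cvgM; [exact: cvg_cst | exact: cvg_id].
have wBA r : w r + B / A = A^-1 * (A * w r + B) by field; rewrite gt_eqF.
have div_exp c X Y s t : X * expR (c * t) <= Y * expR (c * s) ->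
    X <= Y * expR (c * (s - t)).
  by rewrite mulrBr expRB mulrA ler_pdivlMr ?expR_gt0.
move=> s t sab tab; have [st|/ltW ts] := leP s t.
- rewrite ger0_norm ?subr_ge0// -opprB mulrN -mulNr; apply: div_exp.
  apply: (@ler0_derive1_le_cc _ (phi (- A)) a b _ _ (phic _)) => // r rab.
    exact: (@ex_derive _ _ _ _ _ _ _ (dphi _ _ rab)).
  rewrite derive1E (@derive_val _ _ _ _ _ _ _ (dphi _ _ rab)).
  rewrite mulr_le0_ge0 ?expR_ge0// wBA mulNr mulVKf ?gt_eqF// subr_le0.
  apply: le_trans (ler_norm _) _; apply: bnd; exact: subset_itv_oo_cc.
- rewrite distrC ger0_norm ?subr_ge0//; apply: div_exp.
  apply: (@ger0_derive1_le_cc _ (phi A) a b _ _ (phic _)) => // r rab.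
    exact: (@ex_derive _ _ _ _ _ _ _ (dphi _ _ rab)).
  rewrite derive1E (@derive_val _ _ _ _ _ _ _ (dphi _ _ rab)).
  rewrite mulr_ge0 ?expR_ge0// wBA mulVKf ?gt_eqF// -lerBlDl sub0r.
  have : `|dw r| <= A * w r + B by apply: bnd; exact: subset_itv_oo_cc.
  by rewrite ler_norml => /andP[+ _]; rewrite lerNl.
Qed.

End DeriveWithin.

(** * Distance between a trajectory and an approximate one *)

Section ApproximateTrajectories.
Context {R : realType} {n : nat}.
Implicit Types (X : set 'rV[R]_n) (f : 'rV[R]_n -> 'rV[R]_n) (p q : 'rV[R]_n).

(** The norm of row vectors is the maximum norm, which is not differentiable;
    the squared Euclidean distance is, and is comparable to it. *)
Definition sqdist p q : R := \sum_i (p 0 i - q 0 i) ^+ 2.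

Lemma coord_le_norm p i : `|p 0 i| <= `|p|.
Proof.
rewrite [leRHS]/Num.norm /= mx_normrE; apply/bigmax_geP; right => /=.
by exists (0, i).
Qed.

Lemma sqr_norm_le_sqdist p q : `|p - q| ^+ 2 <= sqdist p q.
Proof.
have sq0 : 0 <= sqdist p q by apply: sumr_ge0 => i _; exact: sqr_ge0.
have [->|/mx_norm_neq0 [[i j] /= pq]] := eqVneq (`|p - q|) 0.
  by rewrite expr0n.
rewrite [`|p - q|]pq (ord1 i) real_normK ?num_real// !mxE.
by rewrite /sqdist (bigD1 j) //= lerDl; apply: sumr_ge0 => k _; exact: sqr_ge0.
Qed.

Lemma sqdist_le_sqr_norm p q : sqdist p q <= n%:R * `|p - q| ^+ 2.
Proof.
rewrite mulr_natl -[X in _ *+ X]card_ord -sumr_const; apply: ler_sum => i _.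
rewrite -real_normK ?num_real// lerXn2r ?nnegrE//.
by have := coord_le_norm (p - q) i; rewrite !mxE.
Qed.

Lemma is_derive_within_coord (D : set R) (u : R -> 'rV[R]_n) t v i :
  is_derive_within idfun D u t v ->
  is_derive_within idfun D (fun s => u s 0 i) t (v 0 i).
Proof.
move=> du; rewrite /is_derive_within.
have -> : (fun s => (s - t)^-1 *: (u s 0 i - u t 0 i)) =
   (fun M : 'rV[R]_n => M 0 i) \o (fun s => (s - t)^-1 *: (u s - u t)).
  by apply/funext => s /=; rewrite !mxE.
by apply: continuous_cvg => //; exact: coord_continuous.
Qed.

Lemma sqdist_derive (D : set R) (u v : R -> 'rV[R]_n) t du dv :
  is_derive_within idfun D u t du -> is_derive_within idfun D v t dv ->
  is_derive_within idfun D (fun s => sqdist (u s) (v s)) t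
    (\sum_i (du 0 i - dv 0 i) * (u t 0 i - v t 0 i + (u t 0 i - v t 0 i))).
Proof.
move=> hu hv; rewrite /is_derive_within.
pose x i s := u s 0 i - v s 0 i.
have -> : (fun s => (s - t)^-1 *: (sqdist (u s) (v s) - sqdist (u t) (v t))) =
   (fun s => \sum_i ((s - t)^-1 *: (u s 0 i - u t 0 i) -
       (s - t)^-1 *: (v s 0 i - v t 0 i)) * (x i s + x i t)).
  apply/funext => s; rewrite /sqdist -sumrB scaler_sumr; apply: eq_bigr => i _.
  by rewrite /x /GRing.scale /=; ring.
apply: (cvg_big add_continuous) => i _.
have hui := is_derive_within_coord (i := i) hu.
have hvi := is_derive_within_coord (i := i) hv.
apply: cvgM; first exact: cvgB.
apply: cvgD; last exact: cvg_cst.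
by apply: cvgB; [exact: derive_within_cvg hui | exact: derive_within_cvg hvi].
Qed.

(** Growth rate of the squared distance between trajectories of a vector field
    with Lipschitz constant [L] for the maximum norm; the last summand only keeps
    it positive when [n = 0]. *)
Definition lip_rate (L : R) : R := n%:R * (2 * L + 1) + 1.

Lemma lip_rate_gt0 L : 0 <= L -> 0 < lip_rate L.
Proof.
move=> L0; rewrite /lip_rate ltr_wpDl //.
by rewrite mulr_ge0 // addr_ge0 // mulr_ge0.
Qed.

(** The curve [v] solves the equation up to an error [M].  It will be another
    trajectory ([M = 0]) or a constant [p] ([M = |f p|]).  With [N = |u - v|], the
    derivative of the squared distance is at most [n (L N + M) 2 N], and
    [2 M N <= M^2 + N^2]. *)
Lemma approx_trajectory_dist X f (L M a b : R) (u v dv : R -> 'rV[R]_n) :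
  0 <= L -> (forall p q, X p -> X q -> `|f p - f q| <= L * `|p - q|) ->
  trajectory X f a b u ->
  (forall t, t \in `[a, b] -> [/\ X (v t),
     is_derive_within idfun [set` `[a, b]] v t (dv t) &
     `|f (v t) - dv t| <= M]) ->
  let A := lip_rate L in let B := n%:R * M ^+ 2 in
  forall s t, s \in `[a, b] -> t \in `[a, b] ->
  `|u t - v t| ^+ 2 + B / A <=
    (n%:R * `|u s - v s| ^+ 2 + B / A) * expR (A * `|t - s|).
Proof.
move=> L0 lip tu tv A B s t sab tab.
have A0 : 0 < A by exact: lip_rate_gt0.
apply: (@le_trans _ _ (sqdist (u t) (v t) + B / A)).
  by rewrite lerD2r sqr_norm_le_sqdist.
apply: (@le_trans _ _
    ((sqdist (u s) (v s) + B / A) * expR (A * `|t - s|))); last first.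
  by rewrite ler_wpM2r ?expR_ge0// lerD2r sqdist_le_sqr_norm.
pose dw r := \sum_i (f (u r) 0 i - dv r 0 i) *
  (u r 0 i - v r 0 i + (u r 0 i - v r 0 i)).
apply: (@gronwall _ (fun r => sqdist (u r) (v r)) dw a b) => // r rab.
  by have [_ du] := tu r rab; have [_ hv _] := tv r rab; exact: sqdist_derive.
have [Xu _] := tu r rab; have [Xv _ vM] := tv r rab.
set N := `|u r - v r|.
have N0 : 0 <= N := normr_ge0 _.
have M0 : 0 <= M by apply: le_trans vM.
apply: (@le_trans _ _ (n%:R * ((L * N + M) * (N + N)))).
  apply: le_trans (ler_norm_sum _ _ _) _.
  rewrite mulr_natl -[X in _ *+ X]card_ord -sumr_const; apply: ler_sum => i _.
  have ui : `|u r 0 i - v r 0 i| <= N.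
    by have := coord_le_norm (u r - v r) i; rewrite !mxE.
  rewrite normrM ler_pM//.
    have := coord_le_norm (f (u r) - dv r) i; rewrite !mxE => /le_trans; apply.
    rewrite -[_ - _](subrKA (f (v r))); apply: le_trans (ler_normD _ _) _.
    by apply: lerD => //; exact: lip.
  by apply: le_trans (ler_normD _ _) _; exact: lerD.
have Nw : N ^+ 2 <= sqdist (u r) (v r) by exact: sqr_norm_le_sqdist.
apply: (@le_trans _ _ (A * N ^+ 2 + B)); last first.
  by rewrite lerD2r ler_wpM2l // ltW.
have n0 : 0 <= n%:R :> R by [].
rewrite /A /B /lip_rate -subr_ge0.
have -> : (n%:R * (2 * L + 1) + 1) * N ^+ 2 + n%:R * M ^+ 2 -
   n%:R * ((L * N + M) * (N + N)) = n%:R * (N - M) ^+ 2 + N ^+ 2 by ring.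
by apply: addr_ge0; [apply: mulr_ge0 => // | ]; exact: sqr_ge0.
Qed.

End ApproximateTrajectories.

(** * The flow, the flowout and the hitting time *)

Section Flow.
Context {R : realType} {n : nat}.
Implicit Types (X Gamma : set 'rV[R]_n) (f : 'rV[R]_n -> 'rV[R]_n).
Implicit Types (u v : R -> 'rV[R]_n) (x y : 'rV[R]_n).

Lemma lipschitz_bound X f : [lipschitz f x | x in X] ->
  exists2 L : R, 0 <= L &
    forall p q, X p -> X q -> `|f p - f q| <= L * `|p - q|.
Proof.
move=> /pinfty_ex_gt0[L L0 hL]; exists L; first exact: ltW.
by move=> p q Xp Xq; exact: (hL (p, q)).
Qed.

Lemma trajectory_subset X f (a b c d : R) u : a <= c -> d <= b ->
  trajectory X f a b u -> trajectory X f c d u.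
Proof.
move=> ac db tu t tcd.
have sub : [set` `[c, d]] `<=` [set` `[a, b]].
  by move=> s /=; rewrite !in_itv /= => /andP[cs sd]; apply/andP; split; lra.
have [Xu du] := tu t (sub t tcd); split => //.
exact: is_derive_within_subset du.
Qed.

Lemma trajectory_shift X f (a b c : R) u : trajectory X f a b u ->
  trajectory X f (a + c) (b + c) (fun s => u (s - c)).
Proof.
move=> tu t tab.
have shift_itv s : s \in `[a + c, b + c] -> s - c \in `[a, b].
  by rewrite !in_itv /= lerBrDr lerBlDr.
have [Xu du] := tu (t - c) (shift_itv _ tab); split => //.
rewrite /is_derive_within /=.
have -> : (fun s => (s - t)^-1 *: (u (s - c) - u (t - c))) =
  (fun s => (s - (t - c))^-1 *: (u s - u (t - c))) \o (fun s => s - c).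
  by apply/funext => s /=; congr (_^-1 *: _); ring.
apply: cvg_comp; last exact: du.
move=> P; rewrite /within /dnbhs /= => hP.
have ct : {for t, continuous (fun s : R => s - c)}.
  by apply: cvgB; [exact: cvg_id | exact: cvg_cst].
have ctP := ct _ hP.
change (\forall s \near t, s != t -> s \in `[a + c, b + c] -> P (s - c)).
near=> s => st sab.
have hs : s - c != t - c -> s - c \in `[a, b] -> P (s - c).
  by near: s; exact: ctP.
apply: hs; last exact: shift_itv.
by apply: contra st => /eqP st; apply/eqP; lra.
Unshelve. all: end_near. Qed.

Arguments trajectory_shift {X f a b} c {u}.

Section Lipschitz.
Variables (X : set 'rV[R]_n) (f : 'rV[R]_n -> 'rV[R]_n) (L : R).
Hypotheses (L0 : 0 <= L)
  (lip : forall p q, X p -> X q -> `|f p - f q| <= L * `|p - q|).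

Lemma trajectory_unique (a b c t : R) u v :
  trajectory X f a b u -> trajectory X f a b v ->
  c \in `[a, b] -> t \in `[a, b] -> u c = v c -> u t = v t.
Proof.
move=> tu tv cab tab uv.
have tv' r : r \in `[a, b] -> [/\ X (v r),
    is_derive_within idfun [set` `[a, b]] v r (f (v r)) &
    `|f (v r) - f (v r)| <= 0].
  by move=> /tv[Xv dv]; rewrite subrr normr0.
have := approx_trajectory_dist L0 lip tu tv' cab tab.
rewrite uv subrr normr0 expr0n /= !mulr0 mul0r !addr0 mul0r => uv0.
apply/eqP; rewrite -subr_eq0 -normr_eq0 -sqrf_eq0 eq_le uv0.
exact: sqr_ge0.
Qed.

(** The time [t - s] may have either sign: existence comes from translating [u],
    and the value of the flow from uniqueness of trajectories. *)
Lemma flow_along (a b s t : R) u : trajectory X f a b u ->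
  s \in `[a, b] -> t \in `[a, b] ->
  flow_defined X f (t - s) (u s) /\ flow X f (t - s) (u s) = u t.
Proof.
move=> tu sab tab.
have hto : flow_to X f (t - s) (u s) (u t).
  exists (fun r => u (r - - s)).
  split; [|by rewrite opprK add0r|by rewrite opprK subrK].
  apply: (trajectory_subset _ _ (trajectory_shift (- s) tu)).
    move: sab tab; rewrite !in_itv /= le_min => /andP[? ?] /andP[? ?].
    by apply/andP; split; lra.
  move: sab tab; rewrite !in_itv /= ge_max => /andP[? ?] /andP[? ?].
  by apply/andP; split; lra.
split; first by exists (u t).
apply: xget_unique => // y [v [tv v0 <-]].
have [w [tw w0 <-]] := hto.
have in1 : 0 \in `[Num.min 0 (t - s), Num.max 0 (t - s)].
  by rewrite in_itv /= ge_min le_max lexx.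
have in2 : t - s \in `[Num.min 0 (t - s), Num.max 0 (t - s)].
  by rewrite in_itv /= ge_min le_max lexx !orbT.
by apply: (trajectory_unique tv tw in1 in2); rewrite v0 w0.
Qed.

Hypothesis flow_ex : forall x (t : R), X x -> 0 <= t -> flow_defined X f t x.

Lemma forward_trajectory x (t : R) : X x -> 0 <= t ->
  exists2 u, trajectory X f 0 t u & u 0 = x.
Proof.
move=> Xx t0; have [y [u [tu u0 _]]] := flow_ex Xx t0.
by exists u; move: tu; rewrite // min_l// max_r.
Qed.

Variables (T : R) (Gamma : set 'rV[R]_n).
Hypotheses (T0 : 0 < T) (Gamma_sub : Gamma `<=` X)
  (Gamma_nonrec : nonrecurrent X f T Gamma).

(** The trajectory is taken longer than [T] because it is followed beyond [x], for
    at most another time [T]. *)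
Lemma flowout_trajectory x : flowout X f T Gamma x ->
  exists u (a : R),
    [/\ trajectory X f 0 (T + T) u, Gamma (u 0), 0 <= a <= T & u a = x].
Proof.
move=> [a aT [x0 Gx0 <-]].
have T_gt0 := T0; have TT0 : 0 <= T + T by lra.
have [u tu u0] := @forward_trajectory x0 (T + T) (Gamma_sub Gx0) TT0.
exists u, a; move: aT; rewrite /= in_itv /= => /andP[a0 aT].
split=> //; [by rewrite u0 | by rewrite a0 |].
have i0 : 0 \in `[0, T + T] by rewrite in_itv /=; lra.
have ia : a \in `[0, T + T] by rewrite in_itv /=; lra.
by have [_] := flow_along tu i0 ia; rewrite u0 subr0.
Qed.

(** Backward uniqueness from the common end point. *)
Lemma trajectory_meet (a b : R) u v : 0 <= b <= a ->
  trajectory X f 0 a u -> trajectory X f 0 b v -> u a = v b -> u (a - b) = v 0.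
Proof.
move=> /andP[b0 ba] tu tv uv.
have tv' : trajectory X f (a - b) a (fun s => v (s - (a - b))).
  by have := trajectory_shift (a - b) tv; rewrite add0r subrKC.
have tu' : trajectory X f (a - b) a u.
  by apply: (trajectory_subset _ _ tu) => //; lra.
rewrite (@trajectory_unique (a - b) a a (a - b) _ _ tu' tv') ?subrr//.
- by rewrite in_itv /=; lra.
- by rewrite in_itv /=; lra.
- by rewrite uv; congr v; lra.
Qed.

Lemma no_return (s t a b : R) u : trajectory X f a b u ->
  a <= s -> s < t -> t <= b -> t - s <= T -> Gamma (u s) -> ~ Gamma (u t).
Proof.
move=> tu sa st tb tsT Gs.
have is_ : s \in `[a, b] by rewrite in_itv /=; lra.
have it : t \in `[a, b] by rewrite in_itv /=; lra.
have [_ <-] := flow_along tu is_ it.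
by apply: Gamma_nonrec => //; rewrite in_itv /=; lra.
Qed.

Lemma meet_time_le (a b : R) u v : 0 <= a <= T -> 0 <= b <= T ->
  trajectory X f 0 a u -> trajectory X f 0 b v -> Gamma (u 0) -> Gamma (v 0) ->
  u a = v b -> a <= b.
Proof.
move=> aT bT tu tv Gu Gv uv; rewrite leNgt; apply/negP => ba.
have := @trajectory_meet a b u v _ tu tv uv => /(_ ltac:(lra)) E.
by apply: (@no_return 0 (a - b) 0 a u tu) => //; rewrite ?E //; lra.
Qed.

(** Another hitting time would give a second trajectory from [Gamma] to [u a]; by
    [meet_time_le], applied both ways, the two take the same time. *)
Lemma hitting_time_along (a : R) u : 0 <= a <= T ->
  trajectory X f 0 a u -> Gamma (u 0) ->
  hitting_time X f T Gamma (u a) = - a /\ flow X f (- a) (u a) = u 0.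
Proof.
move=> aT tu Gu.
have i0 : 0 \in `[0, a] by rewrite in_itv /=; lra.
have ia : a \in `[0, a] by rewrite in_itv /=; lra.
have [d e] := flow_along tu ia i0; rewrite sub0r in d e.
split=> //; apply: xget_unique.
  by split=> //; [rewrite in_itv /=; lra | rewrite e].
move=> t [tT [y [v [tv v0 vt]]] Gv].
rewrite in_itv /= in tT.
rewrite min_r ?max_l in tv; try lra.
have j0 : 0 \in `[t, 0] by rewrite in_itv /=; lra.
have jt : t \in `[t, 0] by rewrite in_itv /=; lra.
have [_ ] := flow_along tv j0 jt; rewrite subr0 v0 => E; rewrite E in Gv.
have tv' : trajectory X f 0 (- t) (fun s => v (s - - t)).
  by have := trajectory_shift (- t) tv; rewrite subrr add0r.
have tT' : 0 <= - t <= T by lra.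
have w0 : v (- t - - t) = u a by rewrite subrr.
have Gv' : Gamma (v (0 - - t)) by rewrite opprK add0r.
have := meet_time_le aT tT' tu tv' Gu Gv' (esym w0).
have := meet_time_le tT' aT tv' tu Gv' Gu w0.
by lra.
Qed.

(** Beyond time [T], each point of the flowout on the trajectory comes from a
    passage through [Gamma] that is itself later than [T].  A passage [r1] in
    [(T, 2T]], then one [r2] before the middle of [T] and [r1], are less than [T]
    apart. *)
Lemma stay_time_le (a c : R) u : 0 <= a <= T -> a <= c ->
  trajectory X f 0 c u -> Gamma (u 0) ->
  (forall s, a <= s <= c -> flowout X f T Gamma (u s)) -> c <= T.
Proof.
have T_gt0 := T0; move=> aT ac tu Gu stay; rewrite leNgt; apply/negP => Tc.
have recent s : T < s <= c -> exists2 r, T < r <= s & Gamma (u r).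
  move=> sTc; have [|v [b [tv Gv bT vb]]] := flowout_trajectory (stay s _).
    by lra.
  have tus : trajectory X f 0 s u by apply: (trajectory_subset _ _ tu); lra.
  have tvb : trajectory X f 0 b v by apply: (trajectory_subset _ _ tv); lra.
  have E := @trajectory_meet s b u v ltac:(lra) tus tvb (esym vb).
  have Gs : Gamma (u (s - b)) by rewrite E.
  exists (s - b) => //; apply/andP; split; last lra.
  rewrite ltNge; apply/negP => sbT.
  by apply: (@no_return 0 (s - b) 0 c u tu) => //; lra.
pose s1 := Num.min c (T + T).
have s1P : [/\ T < s1, s1 <= c & s1 <= T + T].
  by rewrite /s1 lt_min !ge_min !lexx !orbT; split=> //; lra.
have [s1T s1c s1TT] := s1P.
have [|r1 r1P G1] := recent s1; first lra.
have [|r2 r2P G2] := recent ((T + r1) / 2); first lra.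
by apply: (@no_return r2 r1 0 c u tu) => //; lra.
Qed.

Lemma koopman_dom_trajectory x (t : R) :
  flowout X f T Gamma x -> t \in `[0, T] ->
  (forall t', t' \in `[0, t] -> flowout X f T Gamma (flow X f t' x)) ->
  exists u (a : R), [/\ trajectory X f 0 (a + t) u, Gamma (u 0), 0 <= a &
    [/\ a + t <= T, u a = x & flow X f t x = u (a + t)]].
Proof.
have T_gt0 := T0; move=> /flowout_trajectory[u [a [tu Gu aT <-]]].
rewrite in_itv /= => tT stay.
have fE s : 0 <= s <= t -> flow X f s (u a) = u (a + s).
  move=> st.
  have ia : a \in `[0, T + T] by rewrite in_itv /=; lra.
  have ias : a + s \in `[0, T + T] by rewrite in_itv /=; lra.
  by have [_] := flow_along tu ia ias; rewrite addrC addKr.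
have tu' : trajectory X f 0 (a + t) u by apply: (trajectory_subset _ _ tu); lra.
exists u, a; split=> //; first lra.
split=> //; last by apply: fE; lra.
apply: (@stay_time_le a (a + t) u) => // [|s sP]; first lra.
have -> : s = a + (s - a) by ring.
rewrite -fE; last lra.
by apply: stay; rewrite in_itv /=; lra.
Qed.

End Lipschitz.
End Flow.

(** * Continuity of the starting point *)

Section Entrance.
Context {R : realType} {n : nat}.
Variables (X : set 'rV[R]_n) (f : 'rV[R]_n -> 'rV[R]_n) (L : R).
Hypotheses (L0 : 0 <= L)
  (lip : forall p q, X p -> X q -> `|f p - f q| <= L * `|p - q|).

Lemma is_derive_within_cst (D : set R) (p : 'rV[R]_n) t :
  is_derive_within idfun D (fun=> p) t 0.
Proof.
rewrite /is_derive_within; under eq_fun do rewrite subrr scaler0.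
exact: cvg_cst.
Qed.

(** Let the two travel times be [a] and [a'], and run both trajectories backwards
    from their end points for the shorter one.  What they accumulate is
    controlled by the distance of the end points; over the remaining time
    [|a' - a|], one of them is compared with the constant [u 0]. *)
Lemma start_dist (T a a' : R) (u u' : R -> 'rV[R]_n) :
  let A := @lip_rate R n L in
  0 <= a <= T -> 0 <= a' <= T ->
  trajectory X f 0 (T + T) u -> trajectory X f 0 (T + T) u' ->
  `|u' 0 - u 0| ^+ 2 <=
    (2 * (n%:R * expR (A * T)) + (n%:R * expR (A * T)) ^+ 2) *
      `|u' a' - u a| ^+ 2
    + 2 * (n%:R * `|f (u 0)| ^+ 2 / A) * (expR (A * `|a' - a|) - 1).
Proof.
move=> A aT a'T tu tu'.
have A0 : 0 < A by exact: lip_rate_gt0.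
set D := `|u' a' - u a| ^+ 2; set b := n%:R * _ / A.
set E := n%:R * expR (A * T).
have D0 : 0 <= D by exact: sqr_ge0.
have E0 : 0 <= E by rewrite mulr_ge0 ?expR_ge0.
have b0 : 0 <= b by rewrite divr_ge0 ?mulr_ge0 ?sqr_ge0// ltW.
have i0 : 0 \in `[0, T + T] by rewrite in_itv /=; lra.
have [Xu0 _] := tu 0 i0.
have ge1 d : 0 <= d -> 1 <= expR (A * d).
  by move=> d0; rewrite -expR0 ler_expR mulr_ge0// ltW.
have stay w d s t : trajectory X f 0 d w -> s \in `[0, d] -> t \in `[0, d] ->
    `|w t - u 0| ^+ 2 + b <=
      (n%:R * `|w s - u 0| ^+ 2 + b) * expR (A * `|t - s|).
  move=> tw.
  apply: (@approx_trajectory_dist _ _ X f L _ 0 d w _ (fun=> 0)) => //.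
  by move=> r _; split; [|exact: is_derive_within_cst|rewrite subr0].
have close d w w' : 0 <= d <= T ->
    trajectory X f 0 d w -> trajectory X f 0 d w' ->
    `|w' 0 - w 0| ^+ 2 <= E * `|w' d - w d| ^+ 2.
  move=> dT tw tw'.
  have := approx_trajectory_dist (M := 0) L0 lip tw' (v := w)
    (dv := fun r => f (w r)) _ (s := d) (t := 0).
  rewrite expr0n /= !mulr0 !mul0r !addr0 => /(_ _ _ _) H.
  apply: (le_trans (H _ _ _)).
  - by move=> r /tw[Xw dw]; rewrite subrr normr0.
  - by rewrite in_itv /=; lra.
  - by rewrite in_itv /=; lra.
  rewrite /E mulrAC ler_wpM2r ?sqr_ge0// ler_wpM2l// ler_expR.
  rewrite ler_wpM2l ?(ltW A0)//.
  by rewrite sub0r normrN ger0_norm; lra.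
have [aa'|/ltW aa'] := leP a' a.
- pose d := a - a'.
  have d0 : 0 <= d by rewrite /d; lra.
  have tud : trajectory X f 0 d u.
    by apply: (trajectory_subset _ _ tu); rewrite /d; lra.
  have tus : trajectory X f 0 a' (fun s => u (s - - d)).
    apply: (trajectory_subset _ _ (trajectory_shift (c := - d) tu));
    by rewrite /d; lra.
  have tu's : trajectory X f 0 a' u' by apply: (trajectory_subset _ _ tu'); lra.
  have := close a' _ _ a'T tus tu's.
  rewrite sub0r opprK (_ : a' + d = a); last by rewrite /d; ring.
  rewrite -/D => P.
  have := stay u d 0 d tud; rewrite !in_itv /= !lexx d0.
  rewrite subrr normr0 expr0n /= mulr0 add0r.
  move=> /(_ isT isT); rewrite subr0 ger0_norm// => Q.
  have -> : `|a' - a| = d by rewrite distrC ger0_norm.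
  have tri : `|u' 0 - u 0| <= `|u' 0 - u d| + `|u d - u 0|.
    by rewrite -[u' 0 - u 0](subrKA (u d)); exact: ler_normD.
  have : `|u' 0 - u 0| ^+ 2 <= (`|u' 0 - u d| + `|u d - u 0|) ^+ 2.
    by rewrite lerXn2r ?nnegrE// addr_ge0.
  have := sqr_ge0 (`|u' 0 - u d| - `|u d - u 0|).
  have := mulr_ge0 (sqr_ge0 E) D0.
  nra.
- pose d := a' - a.
  have d0 : 0 <= d by rewrite /d; lra.
  have tu'd : trajectory X f 0 d u'.
    by apply: (trajectory_subset _ _ tu'); rewrite /d; lra.
  have tu's : trajectory X f 0 a (fun s => u' (s - - d)).
    apply: (trajectory_subset _ _ (trajectory_shift (c := - d) tu'));
    by rewrite /d; lra.
  have tus : trajectory X f 0 a u by apply: (trajectory_subset _ _ tu); lra.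
  have := close a _ _ aT tus tu's.
  rewrite sub0r opprK (_ : a + d = a'); last by rewrite /d; ring.
  rewrite -/D => P.
  have := stay u' d d 0 tu'd; rewrite !in_itv /= !lexx d0.
  move=> /(_ isT isT); rewrite sub0r normrN ger0_norm// => Q.
  have nE : n%:R * expR (A * d) <= E.
    by rewrite ler_wpM2l// ler_expR ler_wpM2l ?(ltW A0)// /d; lra.
  have Z0 := sqr_ge0 (`|u' d - u 0|).
  have H1 : n%:R * expR (A * d) * `|u' d - u 0| ^+ 2 <= E * (E * D).
    by apply: ler_pM => //; rewrite mulr_ge0 ?expR_ge0.
  have H2 : 0 <= b * (expR (A * d) - 1) by rewrite mulr_ge0// subr_ge0 ge1.
  have H3 := mulr_ge0 E0 D0.
  nra.
Qed.

Hypothesis flow_ex : forall x (t : R), X x -> 0 <= t -> flow_defined X f t x.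
Variables (T : R) (Gamma : set 'rV[R]_n).
Hypotheses (T0 : 0 < T) (Gamma_sub : Gamma `<=` X)
  (Gamma_nonrec : nonrecurrent X f T Gamma).

Let tau := hitting_time X f T Gamma.
Let XT := flowout X f T Gamma.

Lemma flowout_entrance x : XT x ->
  exists u (a : R), [/\ trajectory X f 0 (T + T) u, 0 <= a <= T, u a = x &
    [/\ Gamma (u 0), tau x = - a & flow X f (tau x) x = u 0]].
Proof.
move=> XTx; have T_gt0 := T0.
have [u [a [tu Gu aT ua]]] :=
  flowout_trajectory L0 lip flow_ex T0 Gamma_sub XTx.
have tua : trajectory X f 0 a u by apply: (trajectory_subset _ _ tu); lra.
have [h1 h2] := hitting_time_along L0 lip Gamma_nonrec aT tua Gu.
by exists u, a; split => //; split => //; rewrite /tau -ua h1.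
Qed.

Lemma entrance_continuous : {within XT, continuous tau} ->
  {within XT, continuous (fun x => flow X f (tau x) x)}.
Proof.
move=> /subspace_continuousP ctau; apply/subspace_continuousP => x XTx.
have [u [a [tu aT ua [Gu tx Ex]]]] := flowout_entrance XTx.
suff : flow X f (tau y) y @[y --> within XT (nbhs x)] --> u 0 by rewrite -Ex.
pose A := @lip_rate R n L; pose b := 2 * (n%:R * `|f (u 0)| ^+ 2 / A).
pose K := 2 * (n%:R * expR (A * T)) + (n%:R * expR (A * T)) ^+ 2.
pose bound y := K * `|y - x| ^+ 2 + b * (expR (A * `|tau y - tau x|) - 1).
have bound_cvg : bound y @[y --> within XT (nbhs x)] --> (0 : R).
  have -> : 0 = bound x.
    by rewrite /bound !subrr !normr0 expr0n /= !mulr0 expR0 subrr mulr0 addr0.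
  apply: cvgD.
    apply: cvgM; first exact: cvg_cst.
    have nx : `|y - x| @[y --> within XT (nbhs x)] --> `|x - x|.
      apply: cvg_norm; apply: cvgB; last exact: cvg_cst.
      exact: cvg_within.
    by under eq_fun do rewrite expr2; rewrite expr2; exact: cvgM.
  apply: cvgM; first exact: cvg_cst.
  apply: cvgB; last exact: cvg_cst.
  apply: continuous_cvg; first exact: continuous_expR.
  apply: cvgM; first exact: cvg_cst.
  by apply: cvg_norm; apply: cvgB; [exact: ctau | exact: cvg_cst].
apply/cvgrPdist_lt => e e0.
near=> y.
have XTy : XT y by near: y; exact: withinT.
have [u' [a' [tu' aT' ua' [Gu' ty Ey]]]] := flowout_entrance XTy; rewrite /= Ey.
have : `|u' 0 - u 0| ^+ 2 <= bound y.
  have := start_dist aT aT' tu tu'; rewrite ua ua' /bound tx ty -/A -/b -/K.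
  by rewrite -opprD normrN.
rewrite distrC => le_bound.
have lt_bound : bound y < e ^+ 2.
  near: y; exact: (cvgr_lt _ bound_cvg _ (exprn_gt0 2 e0)).
rewrite -(@ltr_pXn2r _ 2) ?nnegrE//; last exact: ltW.
exact: le_lt_trans le_bound lt_bound.
Unshelve. all: end_near. Qed.

(** * The vector of generalized eigenfunctions *)

Section Psi.
Variables (m : nat) (lambda : R[i]) (g : 'I_m -> 'rV[R]_n -> R[i]).
Local Notation J := (jordan_block m lambda).
Local Notation psi := (psi_vec X f T Gamma lambda g).

Lemma psi_along (a : R) u :
  0 <= a <= T -> trajectory X f 0 a u -> Gamma (u 0) ->
  psi (u a) = expmx (a%:C *: J) *m \col_i g i (u 0).
Proof.
move=> aT tu Gu; rewrite /psi_vec.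
have [-> ->] := hitting_time_along L0 lip Gamma_nonrec aT tu Gu.
by rewrite opprK.
Qed.

Lemma psi_flow x (t : R) : XT x -> t \in `[0, T] ->
  (forall t', t' \in `[0, t] -> XT (flow X f t' x)) ->
  psi (flow X f t x) = expmx (t%:C *: J) *m psi x.
Proof.
move=> XTx tT stay.
have [u [a [tu Gu a0 [atT ua ->]]]] :=
  koopman_dom_trajectory L0 lip flow_ex T0 Gamma_sub Gamma_nonrec XTx tT stay.
rewrite in_itv /= in tT.
have tua : trajectory X f 0 a u by apply: (trajectory_subset _ _ tu); lra.
rewrite -ua (psi_along _ tu Gu) ?(psi_along _ tua Gu); [|lra|lra].
by rewrite [a + t]addrC [in LHS]expmxD -mulmxA.
Qed.

Lemma psi_continuous i : (forall j, {within Gamma, continuous (g j)}) ->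
  {within XT, continuous tau} -> {within XT, continuous (fun x => psi x i 0)}.
Proof.
move=> cg ctau.
have -> : (fun y => psi y i 0) = fun y =>
    \sum_k expmx ((- tau y)%:C *: J) i k * g k (flow X f (tau y) y).
  apply/funext => y; rewrite /psi_vec mxE.
  by apply: eq_bigr => k _; rewrite mxE.
apply/subspace_continuousP => x XTx.
have cE := entrance_continuous ctau.
move/subspace_continuousP: ctau => ctau; move/subspace_continuousP: cE => cE.
apply: (cvg_big add_continuous) => k _; apply: cvgM.
  apply: (@continuous_cvg _ _ _ _ _ (fun y => - tau y)
            (fun s => expmx (s%:C *: J) i k)).
    exact: is_cderive_continuous (expmx_derive _ _ _ _).
  by apply: cvgN; exact: ctau.
have [u [a [_ _ _ [Gu _ Eu]]]] := flowout_entrance XTx.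
have GE : Gamma (flow X f (tau x) x) by rewrite Eu.
move/subspace_continuousP: (cg k) => /(_ _ GE).
apply: cvg_comp => P hP.
have cEx := cE x XTx _ hP.
change (\forall y \near x, XT y -> P (flow X f (tau y) y)).
have {}cEx : \forall y \near x,
    XT y -> Gamma (flow X f (tau y) y) -> P (flow X f (tau y) y).
  exact: cEx.
apply: filterS cEx => y hy XTy; apply: hy => //.
by have [v [b [_ _ _ [Gv _ ->]]]] := flowout_entrance XTy.
Qed.

Lemma psi_derive x (t : R) :
  let D := [set t : R | t \in `[0, T] /\
             forall t', t' \in `[0, t] -> XT (flow X f t' x)] in
  XT x -> D t ->
  is_derive_within (fun s => s%:C) D (fun s => psi (flow X f s x)) t
    (J *m psi (flow X f t x)).
Proof.
move=> D XTx Dt.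
have psiE s : D s -> psi (flow X f s x) = expmx (s%:C *: J) *m psi x.
  by move=> [sT stay]; exact: psi_flow.
rewrite (psiE _ Dt) mulmxA.
have dF i j : is_cderive (fun s => (expmx (s%:C *: J) *m psi x) i j) t
   ((J *m expmx (t%:C *: J) *m psi x) i j).
  by apply: is_cderive_mulmxl => k; exact: expmx_derive.
apply: (@cvg_trans _ ((s - t)%:C^-1 *: (expmx (s%:C *: J) *m psi x -
    expmx (t%:C *: J) *m psi x) @[s --> within D t^'])).
  apply: near_eq_cvg; near=> s.
  have Ds : D s by near: s; exact: withinT.
  by have e1 := psiE _ Ds; have e2 := psiE _ Dt; rewrite e1 e2.
exact: is_cderive_within_mx dF.
Unshelve. all: end_near. Qed.

End Psi.
End Entrance.

Theorem theorem3 (R : realType) (n : nat) (X : set 'rV[R]_n)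
    (f : 'rV[R]_n -> 'rV[R]_n) (T : R) (Gamma : set 'rV[R]_n)
    (m : nat) (lambda : R[i]) (g : 'I_m -> 'rV[R]_n -> R[i])
    (f_lip : [lipschitz f x | x in X])
    (flow_ex : forall x t, X x -> 0 <= t -> flow_defined X f t x)
    (T_gt0 : 0 < T)
    (Gamma_sub : Gamma `<=` X)
    (Gamma_nonrec : nonrecurrent X f T Gamma)
    (g_cont : forall i, {within Gamma, continuous (g i)}) :
  let S := flow X f in
  let XT := flowout X f T Gamma in
  let J := jordan_block m lambda in
  let psi := psi_vec X f T Gamma lambda g in
  let E := span_on XT (fun i x => psi x i 0) in
  [/\ {within XT, continuous (hitting_time X f T Gamma)} ->
        E `<=` continuous_on XT,
      koopman_invariant X f T Gamma E &
      forall x, XT x ->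
        let D := [set t : R | t \in `[0, T] /\
                   forall t', t' \in `[0, t] -> XT (S t' x)] in
        forall t, D t ->
          psi (S t x) = expmx (t%:C *: J) *m psi x /\
          is_derive_within (fun s => s%:C) D (fun s => psi (S s x)) t
            (J *m psi (S t x))].
Proof.
move=> S XT J psi E.
have [L L0 lip] := lipschitz_bound f_lip.
have psiD x t : XT x -> t \in `[0, T] ->
    (forall t', t' \in `[0, t] -> XT (S t' x)) ->
    psi (S t x) = expmx (t%:C *: J) *m psi x.
  exact: (psi_flow L0 lip flow_ex T_gt0 Gamma_sub Gamma_nonrec).
split.
- move=> ctau h [c hc].
  apply/subspace_continuousP => x XTx.
  change (h y @[y --> within XT (nbhs x)] --> h x); rewrite (hc x XTx).
  apply: (@cvg_trans _
      (\sum_(i < m) c i * psi y i 0 @[y --> within XT (nbhs x)])).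
    apply: near_eq_cvg; near=> y.
    by rewrite [RHS]hc //; near: y; exact: withinT.
  apply: (cvg_big add_continuous) => i _; apply: cvgM; first exact: cvg_cst.
  have /subspace_continuousP psi_cont :
      {within XT, continuous (fun y => psi y i 0)}.
    exact: (psi_continuous L0 lip flow_ex T_gt0 Gamma_sub Gamma_nonrec).
  exact: psi_cont.
- move=> t h tT [c hc].
  (* The row of coefficients c is multiplied by the matrix expmx (t J). *)
  exists (fun x =>
    \sum_(i < m) (\sum_(k < m) c k * expmx (t%:C *: J) k i) * psi x i 0).
    by exists (fun i => \sum_(k < m) c k * expmx (t%:C *: J) k i).
  move=> x /set_mem[XTx stay]; rewrite /koopman /=.
  have XTSx : XT (S t x).
    by apply: stay; move: tT; rewrite !in_itv /= lexx => /andP[-> _].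
  rewrite hc //; under [RHS]eq_bigr do rewrite mulr_suml.
  rewrite exchange_big; apply: eq_bigr => k _.
  rewrite (psiD _ _ XTx tT stay) mxE mulr_sumr; apply: eq_bigr => i _.
  by rewrite mulrA.
- move=> x XTx D t Dt; split; first by case: Dt => tT stay; exact: psiD.
  exact: (psi_derive (lambda := lambda) (g := g) L0 lip flow_ex T_gt0
            Gamma_sub Gamma_nonrec XTx Dt).
Unshelve. all: end_near. Qed.
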